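(* Let $n\ge 6$ and let $F$ be a subgraph of the convex complete graph $K_n$ such that $|E(F)|\le n-2$ and $F$ contains no boundary edge of $K_n$. Then $K_n - F$ admits a triangulation unless $F$ has configuration $\mathcal{F}_n( * )$.
   Context: A convex complete graph $K_m$ is the complete graph on $m$ points in convex position in the plane, edges drawn as straight-line segments. Boundary edges are edges joining vertices consecutive along the convex hull boundary. Two edges with four distinct endpoints cross if the segments intersect, i.e. their endpoints alternate along the boundary. $K_m-F$ denotes the convex graph obtained from $K_m$ by deleting the edges of the subgraph $F$ (all $m$ vertices kept). A convex graph $G$ on $m$ vertices admits a triangulation if it contains a maximal plane straight-line subdivision on vertex set $V(G)$, i.e. $G$ contains all $m$ boundary edges and $m-3$ pairwise non-crossing diagonals. $d_F(v)$ is the degree of $v$ in $F$; a pendant vertex of $F$ is one of degree $1$ in $F$. Configuration $\mathcal{F}_m( * )$: a subgraph $F$ of $K_m$ has this configuration if $F$ has exactly $m-2$ edges, has no isolated vertices (every vertex of $K_m$ meets an edge of $F$), and for some labelling $v_0,\dots,v_{m-1}$ of the vertices of $K_m$ in cyclic order along the boundary (subscripts mod $m$), either (a) $E(F)=\{v_0v_i: i=2,\dots,m-2\}\cup\{v_1v_{m-1}\}$, or (b) there is an integer $k$ with $2\le k\le m-4$ such that: (i) for $i=0,1,\dots,k-1$, $d_F(v_i)\ge 2$ and $v_{i-1}v_{i+1}\in E(F)$; (ii) for $i=k,\dots,m-1$, $d_F(v_i)=1$ and $v_i$ is adjacent in $F$ to a non-pendant vertex of $F$; (iii) whenever $u,v$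 are pendant vertices of $F$ such that the edges $uv_i$ and $vv_j$ of $F$ cross, then $|i-j|=1$. *)

(* Defs.v *)
From HB Require Import structures.
From mathcomp Require Import all_boot all_order all_algebra.

Set Implicit Arguments.
Unset Strict Implicit.
Unset Printing Implicit Defensive.

Import Order.TTheory GRing.Theory Num.Theory.
Local Open Scope ring_scope.

(* Twice the signed area of the triangle abc: positive iff c lies strictly to
   the left of the directed line from a to b. *)
Definition orient (R : realFieldType) (a b c : 'rV[R]_2) : R :=
  (b 0 0 - a 0 0) * (c 0 1 - a 0 1) - (b 0 1 - a 0 1) * (c 0 0 - a 0 0).

(* The n points are the corners of a convex polygon, listed counter-clockwise
   along its boundary: each segment from p i to its cyclic successor is a side
   of the convex hull, with every other point strictly to its left. *)
Definition convex_position (R : realFieldType) (n : nat)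
    (p : 'I_n -> 'rV[R]_2) : Prop :=
  forall i j : 'I_n, j != i -> j != ordS i -> 0 < orient (p i) (p (ordS i)) (p j).

Definition in_segment (R : realFieldType) (a b x : 'rV[R]_2) : Prop :=
  exists t : R, [/\ 0 <= t, t <= 1 & x = (1 - t) *: a + t *: b].

Definition crossing (R : realFieldType) (n : nat) (p : 'I_n -> 'rV[R]_2)
    (a b c d : 'I_n) : Prop :=
  uniq [:: a; b; c; d] /\
  exists x, in_segment (p a) (p b) x /\ in_segment (p c) (p d) x.

(* A graph on the fixed vertex set 'I_n is given by its set of edges, an edge
   being a two-element set of vertices. *)
Definition complete_edges (n : nat) : {set {set 'I_n}} :=
  [set e : {set 'I_n} | #|e| == 2%N].

Definition boundary_edges (n : nat) : {set {set 'I_n}} :=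
  [set [set i; ordS i] | i : 'I_n].

Definition deg (n : nat) (F : {set {set 'I_n}}) (v : 'I_n) : nat :=
  #|[set e in F | v \in e]|.

Definition pendant (n : nat) (F : {set {set 'I_n}}) (v : 'I_n) : bool :=
  deg F v == 1%N.

Definition admits_triangulation (R : realFieldType) (n : nat)
    (p : 'I_n -> 'rV[R]_2) (G : {set {set 'I_n}}) : Prop :=
  boundary_edges n \subset G /\
  exists D : {set {set 'I_n}},
    [/\ D \subset G :\: boundary_edges n,
        #|D| = (n - 3)%N &
        forall a b c d : 'I_n,
          [set a; b] \in D -> [set c; d] \in D -> ~ crossing p a b c d].

(* v 0, ..., v (n - 1) lists the vertices in cyclic order along the boundary,
   with any starting vertex and in either direction; v is extended to all
   natural numbers by periodicity, so that subscripts are read modulo n and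
   v (i + n.-1) is the vertex of subscript i - 1. *)
Definition cyclic_labelling (n : nat) (v : nat -> 'I_n) : Prop :=
  [/\ forall i j : nat, (i < n)%N -> (j < n)%N -> v i = v j -> i = j,
      forall i : nat, v (i + n)%N = v i &
      forall i : nat, [set v i; v i.+1] \in boundary_edges n].

Definition config_a (n : nat) (F : {set {set 'I_n}}) (v : nat -> 'I_n) : Prop :=
  F = [set [set v 0%N; v i] | i : 'I_n & (2 <= i <= n - 2)%N]
      :|: [set [set v 1%N; v n.-1]].

Definition config_b (R : realFieldType) (n : nat) (p : 'I_n -> 'rV[R]_2)
    (F : {set {set 'I_n}}) (v : nat -> 'I_n) (k : nat) : Prop :=
  [/\ (2 <= k <= n - 4)%N,
      forall i : nat, (i < k)%N ->
        (2 <= deg F (v i))%N /\ [set v (i + n.-1)%N; v i.+1] \in F,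
      forall i : nat, (k <= i < n)%N ->
        pendant F (v i) /\
        exists w : 'I_n, [set v i; w] \in F /\ ~~ pendant F w &
      forall (u w : 'I_n) (i j : nat), (i < n)%N -> (j < n)%N ->
        pendant F u -> pendant F w ->
        [set u; v i] \in F -> [set w; v j] \in F ->
        crossing p u (v i) w (v j) -> i = j.+1 \/ j = i.+1].

Definition config_star (R : realFieldType) (n : nat) (p : 'I_n -> 'rV[R]_2)
    (F : {set {set 'I_n}}) : Prop :=
  [/\ #|F| = (n - 2)%N,
      forall x : 'I_n, (0 < deg F x)%N &
      exists v : nat -> 'I_n, cyclic_labelling v /\
        (config_a F v \/ exists k : nat, config_b p F v k)].

(* Main.v *)
(* Cutting off an ear at a vertex meeting [F] and inducting, one sees that at
   most [m - 3] forbidden edges never block all triangulations of an [m]-gon.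
   So if [F] blocks the [n]-gon and [#|F| <= n - 2], then [#|F| = n - 2], and a
   vertex of degree at least 2 has the short diagonal below it in [F], as
   otherwise that vertex could be cut off. No vertex is isolated, as its fan
   would avoid [F]. All remaining information comes from double fans: a diagonal
   [ts] outside [F], completed by fans at vertices [u] and [w] which have no
   [F]-neighbour on their own side of [ts].
   - If two pendant vertices are adjacent, every edge crossing theirs must lie
     in [F], and counting leaves only configuration (a).
   - Otherwise double fans at two pendant vertices show that there is only one
     run of non-pendant vertices, and that crossing edges at pendant vertices
     end at neighbouring vertices of the polygon; this is configuration (b). *)
Require Import Defs.
From HB Require Import structures.
From mathcomp Require Import all_boot all_order all_algebra.
From mathcomp Require Import zify ring lra.

Set Implicit Arguments.
Unset Strict Implicit.
Unset Printing Implicit Defensive.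

Import Order.TTheory GRing.Theory Num.Theory.

(** * Cyclic order of indices and a decision procedure for it *)

(* [x] with [cyc a x b] range over the open arc from [a] to [b]. *)
Definition cyc (a b c : nat) : bool := [|| a < b < c, b < c < a | c < a < b].

Lemma cyc_or a b c : cyc a b c ->
  [\/ (a < b /\ b < c)%coq_nat, (b < c /\ c < a)%coq_nat | (c < a /\ a < b)%coq_nat].
Proof.
by case/or3P=> /andP[/ssrnat.ltP ? /ssrnat.ltP ?];
  [constructor 1|constructor 2|constructor 3].
Qed.

Lemma cycN_or a b c : ~~ cyc a b c ->
  [\/ (c <= b /\ b <= a)%coq_nat, (b <= a /\ a <= c)%coq_nat
    | (a <= c /\ c <= b)%coq_nat].
Proof.
rewrite /cyc !negb_or !negb_and -!leqNgt => H.
suff: [|| c <= b <= a, b <= a <= c | a <= c <= b].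
  by case/or3P=> /andP[/ssrnat.leP ? /ssrnat.leP ?];
    [constructor 1|constructor 2|constructor 3].
lia.
Qed.

Lemma ord_neq_or n (a b : 'I_n) : a != b -> (a < b)%coq_nat \/ (b < a)%coq_nat.
Proof. by rewrite -val_eqE neq_ltn => /orP[] /ssrnat.ltP; auto. Qed.

Lemma ord_eq_nat n (a b : 'I_n) : a == b -> a = b :> nat.
Proof. by move/eqP->. Qed.

(* [lia] alone explodes on several [cyc] hypotheses: split them one at a time,
   closing contradictory branches as early as possible. *)
Ltac cyc_split := first [ solve [lia] |
  lazymatch goal with
  | H : _ \/ _ |- _ => destruct H; cyc_split
  | H : or3 _ _ _ |- _ => destruct H; cyc_split
  end].

Ltac cyc_lia :=
  clear; intros;
  lazymatch goal with
  | |- False => idtac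
  | |- ~ _ => intro
  | |- is_true (~~ _) => apply/negP=> ?
  | |- is_true _ => apply: contraT => ?
  | |- _ => exfalso
  end;
  repeat match goal with
  | H : is_true (_ && _) |- _ =>
       let H1 := fresh in let H2 := fresh in case/andP: H => H1 H2
  | H : is_true (_ || _) |- _ => case/orP: H => H
  | H : is_true (~~ (_ || _)) |- _ => rewrite negb_or in H
  | H : is_true (~~ (_ && _)) |- _ => rewrite negb_and in H
  | H : is_true (~~ (~~ _)) |- _ => rewrite negbK in H
  | H : is_true (_ != _) |- _ => apply ord_neq_or in H
  | H : is_true (_ == _) |- _ => apply ord_eq_nat in H
  | H : is_true (~~ cyc _ _ _) |- _ => apply cycN_or in H
  | H : is_true (cyc _ _ _) |- _ => apply cyc_or in H
  | H : is_true (~~ (_ <= _)) |- _ => rewrite -ltnNge in H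
  | H : is_true (_ <= _) |- _ => apply (elimT ssrnat.leP) in H
  end;
  repeat match goal with
  | H : _ \/ _ |- _ => revert H
  | H : or3 _ _ _ |- _ => revert H
  | H : (_ <= _)%coq_nat |- _ => revert H
  | H : @eq nat _ _ |- _ => revert H
  end; clear; intros; cyc_split.

(** * Triangulations of the polygons spanned by subsets of the vertices *)

Section Polygons.
Variable n : nat.
Implicit Types (a b c d s t u v w x y : 'I_n) (S : {set 'I_n}).
Implicit Types (e : {set 'I_n}) (D F : {set {set 'I_n}}).

(* A diagonal of the polygon [S] is a chord having points of [S] on both sides. *)
Definition diagonals S : {set {set 'I_n}} :=
  [set e | [exists a in S, exists b in S,
    [&& e == [set a; b], [exists c in S, cyc a c b] & [exists d in S, cyc b d a]]]].

(* As [c] and [d] may be exchanged, testing one of the two ways of alternating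
   suffices. *)
Definition plane D : bool :=
  [forall a, forall b, forall c, forall d,
    ([set a; b] \in D) ==> ([set c; d] \in D) ==> ~~ (cyc a c b && cyc b d a)].

(** Only the chosen diagonals must avoid [F]; the sides of [S] are not tested. A plane set of
    diagonals of a polygon has at most [#|S| - 3] elements, so the cardinality encodes
    maximality. *)
Definition triangulable F S : bool :=
  [exists D : {set {set 'I_n}},
    [&& D \subset diagonals S :\: F, plane D & #|D| == #|S| - 3]].

(** That is, [ab] is a side of the polygon [S], directed counter-clockwise. *)
Definition next S a b : Prop :=
  [/\ a \in S, b \in S, a != b & forall x, x \in S -> ~~ cyc a x b].

Lemma diagonalsP S e :
  reflect (exists a b c d, [/\ e = [set a; b],
             [/\ a \in S, b \in S, c \in S & d \in S], cyc a c b & cyc b d a])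
          (e \in diagonals S).
Proof.
rewrite inE; apply: (iffP exists_inP) => [[a aS /exists_inP[b bS]]|].
  case/and3P=> /eqP-> /exists_inP[c cS acb] /exists_inP[d dS bda].
  by exists a, b, c, d.
move=> [a [b [c [d [-> [aS bS cS dS] acb bda]]]]]; exists a => //.
apply/exists_inP; exists b => //; rewrite eqxx /=; apply/andP.
by split; apply/exists_inP; [exists c | exists d].
Qed.

Lemma planeP D :
  reflect (forall a b c d, [set a; b] \in D -> [set c; d] \in D ->
             ~~ (cyc a c b && cyc b d a))
          (plane D).
Proof.
apply: (iffP idP) => [H a b c d abD cdD|H].
  by have /forallP/(_ a)/forallP/(_ b)/forallP/(_ c)/forallP/(_ d) := H;
    rewrite abD cdD.
do 4![apply/forallP=> ?]; apply/implyP=> ?; apply/implyP=> ?; exact: H.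
Qed.

Lemma triangulableP F S :
  reflect (exists D, [/\ D \subset diagonals S, [disjoint D & F], plane D &
             #|D| = #|S| - 3])
          (triangulable F S).
Proof.
apply: (iffP existsP) => [[D]|[D [DS DF pD cD]]]; last first.
  by exists D; rewrite subsetD DS DF pD cD eqxx.
by rewrite subsetD => /and3P[/andP[DS DF] pD /eqP cD]; exists D.
Qed.

Lemma diagonal_sub S e : e \in diagonals S -> e \subset S.
Proof.
case/diagonalsP=> a [b [c [d [-> [aS bS _ _] _ _]]]].
by rewrite subUset !sub1set aS.
Qed.

Lemma diagonalsS S1 S2 : S1 \subset S2 -> diagonals S1 \subset diagonals S2.
Proof.
move=> /subsetP sS; apply/subsetP => e /diagonalsP[a [b [c [d [-> [aS bS cS dS] ? ?]]]]].
by apply/diagonalsP; exists a, b, c, d; split=> //; split; apply: sS.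
Qed.

Lemma set2_inj (T : finType) (a b c d : T) :
  [set a; b] = [set c; d] -> (a = c /\ b = d) \/ (a = d /\ b = c).
Proof.
move=> E.
have: a \in [set c; d] by rewrite -E set21.
have: b \in [set c; d] by rewrite -E set22.
have: c \in [set a; b] by rewrite E set21.
have: d \in [set a; b] by rewrite E set22.
by rewrite !inE => /orP[] /eqP ? /orP[] /eqP ? /orP[] /eqP ? /orP[] /eqP ?;
  subst; auto.
Qed.

Lemma diagonals_cyc S t s : [set t; s] \in diagonals S ->
  (exists2 c, c \in S & cyc t c s) /\ (exists2 c, c \in S & cyc s c t).
Proof.
case/diagonalsP=> a [b [c [d [E [aS bS cS dS] acb bda]]]].
case: (set2_inj E) => -[? ?]; subst; split; by [exists c | exists d].
Qed.

Lemma cycN_eq (S : {set 'I_n}) t s x : t != s -> ~~ cyc t x s -> ~~ cyc s x t ->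
  (x == t) || (x == s).
Proof. cyc_lia. Qed.

Lemma cyc_sides a b c d t s : t != s ->
  ~~ cyc s a t -> ~~ cyc s b t -> ~~ cyc t c s -> ~~ cyc t d s ->
  ~~ (cyc a c b && cyc b d a).
Proof. cyc_lia. Qed.

(** Triangulations of the two pieces are glued along [ts]. The pieces share exactly [t] and [s], so
    their sizes add up to [#|S| + 2], and [(#|S1| - 3) + (#|S2| - 3) + 1 = #|S| - 3]. *)
Lemma cut_triangulable F S t s c d :
  t \in S -> s \in S -> c \in S -> d \in S ->
  cyc t c s -> cyc s d t -> [set t; s] \notin F ->
  triangulable F [set x in S | ~~ cyc s x t] ->
  triangulable F [set x in S | ~~ cyc t x s] ->
  triangulable F S.
Proof.
move=> tS sS cS dS tcs sdt tsF.
set S1 := [set x in S | _]; set S2 := [set x in S | _].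
have ts : t != s by move: tcs; cyc_lia.
have c1 : ~~ cyc s t t by cyc_lia.
have c2 : ~~ cyc t t s by cyc_lia.
have c3 : ~~ cyc s s t by cyc_lia.
have c4 : ~~ cyc t s s by cyc_lia.
case/triangulableP=> D1 [D1S D1F pD1 cD1].
case/triangulableP=> D2 [D2S D2F pD2 cD2].
have S12 : S1 :|: S2 = S.
  apply/setP=> x; rewrite !inE -andb_orr andb_idr // => _.
  by cyc_lia.
have I12 : S1 :&: S2 = [set t; s].
  apply/setP=> x; rewrite !inE; apply/idP/idP => [/andP[/andP[xS h1] /andP[_ h2]]|].
    exact: cycN_eq h2 h1.
  by case/orP=> /eqP->; rewrite ?tS ?sS ?c1 ?c2 ?c3 ?c4.
have cS12 : #|S1| + #|S2| = #|S| + 2.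
  by rewrite -cardsUI S12 I12 cards2 ts.
have tI : t \in S1 :&: S2 by rewrite I12 set21.
have sI : s \in S1 :&: S2 by rewrite I12 set22.
(* Each piece has at least three points, so the truncated subtractions in the final count are
   exact. *)
have gt2 (A : {set 'I_n}) x :
    x != t -> x != s -> t \in A -> s \in A -> x \in A -> 2 < #|A|.
  move=> xt xs tA sA xA; have: x |: [set t; s] \subset A.
    by rewrite !subUset !sub1set xA tA.
  by move/subset_leq_card; rewrite cardsU1 cards2 ts !inE (negPf xt) (negPf xs).
have S1gt : 2 < #|S1|.
  case/setIP: tI sI => tA _ /setIP[sA _]; apply: (gt2 S1 c) => //.
  - by move: tcs; cyc_lia.
  - by move: tcs; cyc_lia.
  - by rewrite inE cS /=; move: tcs; cyc_lia.
have S2gt : 2 < #|S2|.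
  case/setIP: tI sI => _ tA /setIP[_ sA]; apply: (gt2 S2 d) => //.
  - by move: sdt; cyc_lia.
  - by move: sdt; cyc_lia.
  - by rewrite inE dS /=; move: sdt; cyc_lia.
(* In either piece [ts] is a side, hence not one of its diagonals. *)
have tsD1 : [set t; s] \notin D1.
  apply/negP=> /(subsetP D1S)/diagonals_cyc[_ [x]].
  by rewrite inE => /andP[_ /negPf->].
have tsD2 : [set t; s] \notin D2.
  apply/negP=> /(subsetP D2S)/diagonals_cyc[[x]].
  by rewrite inE => /andP[_ /negPf->].
(* A common diagonal would lie in both pieces, so it would be [ts] itself. *)
have dis12 : [disjoint D1 & D2].
  apply/pred0Pn => -[e /= /andP[eD1 eD2]].
  have /diagonal_sub e1 := subsetP D1S _ eD1; have /diagonal_sub e2 := subsetP D2S _ eD2.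
  have e12 : e \subset [set t; s] by rewrite -I12 subsetI e1.
  have /diagonalsP[a [b [x [y [E _ axb _]]]]] := subsetP D1S _ eD1.
  case/negP: tsD1; rewrite -(_ : e = [set t; s]) //.
  apply/eqP; rewrite eqEcard e12 cards2 ts E cards2.
  by rewrite (_ : a != b) //; move: axb; cyc_lia.
apply/triangulableP; exists ([set t; s] |: (D1 :|: D2)); split.
- rewrite !subUset sub1set; apply/and3P; split.
  + by apply/diagonalsP; exists t, s, c, d.
  + by apply: (subset_trans D1S); apply: diagonalsS; rewrite -S12 subsetUl.
  + by apply: (subset_trans D2S); apply: diagonalsS; rewrite -S12 subsetUr.
- by rewrite -setI_eq0 !setIUl !setU_eq0 !setI_eq0 disjoints1 tsF D1F D2F.
- have in1 a b : [set a; b] \in D1 -> ~~ cyc s a t /\ ~~ cyc s b t.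
    move/(subsetP D1S)/diagonal_sub; rewrite subUset !sub1set !inE.
    by case/andP=> /andP[_ ->] /andP[_ ->].
  have in2 a b : [set a; b] \in D2 -> ~~ cyc t a s /\ ~~ cyc t b s.
    move/(subsetP D2S)/diagonal_sub; rewrite subUset !sub1set !inE.
    by case/andP=> /andP[_ ->] /andP[_ ->].
  have in0 a b : [set a; b] == [set t; s] ->
      (~~ cyc s a t /\ ~~ cyc s b t) /\ (~~ cyc t a s /\ ~~ cyc t b s).
    by move/eqP/set2_inj=> [] [-> ->].
  have st : s != t by rewrite eq_sym.
  apply/planeP=> a b x y; rewrite !in_setU !in_set1.
  case/or3P=> [/in0[[a1 b1] [a2 b2]]|abD|abD] /or3P[/in0[[x1 y1] [x2 y2]]|xyD|xyD].
  + exact: (cyc_sides ts).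
  + by have [? ?] := in1 _ _ xyD; exact: (cyc_sides st).
  + by have [? ?] := in2 _ _ xyD; exact: (cyc_sides ts).
  + by have [? ?] := in1 _ _ abD; exact: (cyc_sides ts).
  + exact: (planeP _ pD1).
  + by have [? ?] := in1 _ _ abD; have [? ?] := in2 _ _ xyD; exact: (cyc_sides ts).
  + by have [? ?] := in2 _ _ abD; exact: (cyc_sides st).
  + by have [? ?] := in2 _ _ abD; have [? ?] := in1 _ _ xyD; exact: (cyc_sides st).
  + exact: (planeP _ pD2).
- rewrite cardsU1 in_setU negb_or tsD1 tsD2 /= cardsU disjoint_setI0 // cards0 cD1 cD2.
  move: S1gt S2gt cS12; move: #|S1| #|S2| #|S|; clear.
  by lia.
Qed.

Lemma triangle_triangulable F S : #|S| = 3 -> triangulable F S.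
Proof.
move=> S3; apply/triangulableP; exists set0; split.
- exact: sub0set.
- by rewrite -setI_eq0 set0I.
- by apply/planeP=> a b c d; rewrite inE.
- by rewrite S3 cards0.
Qed.

(** Cut along [ab]: one piece is the triangle [a v b], and [d] ensures that [ab] is a diagonal. *)
Lemma ear_triangulable F S a v b d :
  next S a v -> next S v b -> d \in S -> cyc b d a -> [set a; b] \notin F ->
  triangulable F (S :\ v) -> triangulable F S.
Proof.
move=> [aS vS av nav] [_ bS vb nvb] dS bda abF tS.
have avb : cyc a v b.
  move: (nav _ bS) bda av vb; cyc_lia.
apply: (cut_triangulable (t := a) (s := b) (c := v) (d := d)) => //.
- apply: triangle_triangulable.
  rewrite (_ : [set x in S | _] = v |: [set a; b]).
    rewrite cardsU1 cards2 !inE (eq_sym v a) (negPf av) (negPf vb) /=.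
    by rewrite (_ : a != b) //; move: bda; cyc_lia.
  apply/setP=> x; rewrite !inE; apply/idP/idP => [/andP[xS]|].
    move: (nav _ xS) (nvb _ xS) av vb avb; cyc_lia.
  case/or3P=> /eqP->; rewrite ?vS ?aS ?bS /=.
  + by move: avb; cyc_lia.
  + by cyc_lia.
  + by cyc_lia.
- rewrite (_ : [set x in S | _] = S :\ v) //.
  apply/setP=> x; rewrite !inE andbC; case xS: (x \in S); rewrite ?andbF ?andbT //.
  apply/idP/idP; move: (nav _ xS) (nvb _ xS) av vb avb; cyc_lia.
Qed.

Lemma exists_notin (r : seq 'I_n) (S : {set 'I_n}) :
  size r < #|S| -> exists2 x, x \in S & x \notin r.
Proof.
move=> rS; apply/subsetPn; apply: contraL rS => /subset_leq_card/leq_trans.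
by rewrite -leqNgt; apply; apply: card_size.
Qed.

Lemma next_exists S v : v \in S -> 1 < #|S| -> exists x, next S v x.
Proof.
move=> vS S1; have [x0 x0S] : exists2 x, x \in S & x \notin [:: v].
  exact: exists_notin.
rewrite inE => x0v.
(* The counter-clockwise distance from [v]; no point of [S] lies between [v] and a minimizer. *)
pose dist x := if v <= x then x - v else n + x - v.
have Px0 : x0 \in S :\ v by rewrite !inE x0v.
case: (arg_minnP dist Px0) => x /setD1P[xv xS] minx.
exists x; split; rewrite 1?eq_sym // => y yS; apply/negP => vyx.
have yv : y != v by move: vyx; cyc_lia.
have /minx : y \in S :\ v by rewrite !inE yv.
rewrite /dist.
by move: vyx xv yv (ltn_ord x) (ltn_ord y) (ltn_ord v);
  case: (leqP v x); case: (leqP v y); cyc_lia.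
Qed.

Lemma prev_exists S v : v \in S -> 1 < #|S| -> exists x, next S x v.
Proof.
move=> vS S1; have [x0 x0S] : exists2 x, x \in S & x \notin [:: v].
  exact: exists_notin.
rewrite inE => x0v.
pose dist x := if x <= v then v - x else n + v - x.
have Px0 : x0 \in S :\ v by rewrite !inE x0v.
case: (arg_minnP dist Px0) => x /setD1P[xv xS] minx.
exists x; split=> // y yS; apply/negP => xyv.
have yv : y != v by move: xyv; cyc_lia.
have /minx : y \in S :\ v by rewrite !inE yv.
rewrite /dist.
by move: xyv xv yv (ltn_ord x) (ltn_ord y) (ltn_ord v);
  case: (leqP x v); case: (leqP y v); cyc_lia.
Qed.

(** Repeatedly cut off the neighbour [x] of [v]: the diagonal used ends at [v], hence avoids [F]. *)
Lemma fan_triangulable F S v :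
  v \in S -> 2 < #|S| -> (forall x, x \in S -> [set v; x] \notin F) ->
  triangulable F S.
Proof.
have [m] := ubnP #|S|; elim: m => // m IHm in S * => Sm vS S2 vF.
have [S3|S3] := eqVneq #|S| 3; first exact: triangle_triangulable.
have S4 : 3 < #|S| by rewrite ltn_neqAle eq_sym S3.
have [x nvx] : exists x, next S v x by apply: next_exists => //; lia.
have [_ xS vx vxN] := nvx.
have [y nxy] : exists y, next S x y by apply: next_exists => //; lia.
have [_ yS xy xyN] := nxy.
have [d dS] : exists2 d, d \in S & d \notin [:: v; x; y].
  exact: exists_notin.
rewrite !inE !negb_or => /and3P[dv dx dy].
have cS : #|S :\ x| = #|S|.-1 by rewrite (cardsD1 x S) xS.
apply: (ear_triangulable (d := d) nvx nxy dS).
- have vy : v != y.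
    apply/eqP=> vy; move: (vxN _ dS) (xyN _ dS) dv dx vx; rewrite -vy.
    by cyc_lia.
  move: (vxN _ dS) (xyN _ dS) (vxN _ yS) dv dx dy vx xy vy.
  by cyc_lia.
- exact: vF.
- apply: IHm; rewrite ?cS.
  + by rewrite -ltnS prednK // (ltn_trans _ S4).
  + by rewrite !inE vx.
  + by rewrite ltn_predRL.
  + by move=> z /setD1P[_ /vF].
Qed.

Lemma next_inj S a b v w : next S a v -> next S b w -> v = w -> a = b.
Proof.
move=> [aS _ av avN] [bS _ bw bwN] vw; subst w; apply/eqP.
move: (avN _ bS) (bwN _ aS) av bw; cyc_lia.
Qed.

Lemma next_fun S a b v w : next S v a -> next S w b -> v = w -> a = b.
Proof.
move=> [_ aS av avN] [_ bS bw bwN] vw; subst w; apply/eqP.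
move: (avN _ bS) (bwN _ aS) av bw; cyc_lia.
Qed.

(** Removing [v] creates only the side [ab], so the condition that no side lies in [F] survives
    cutting off an ear whose diagonal avoids [F]. *)
Lemma next_setD1 S a v b x y :
  next S a v -> next S v b -> next (S :\ v) x y -> next S x y \/ x = a /\ y = b.
Proof.
move=> [aS vS av avN] [_ bS vb vbN] [/setD1P[xv xS] /setD1P[yv yS] xy xyN].
have [xvy|xvy] := boolP (cyc x v y); [right | left].
  have aD : a \in S :\ v by rewrite !inE av.
  have bD : b \in S :\ v by rewrite !inE eq_sym vb.
  split; apply/eqP.
    by move: (xyN _ aD) (avN _ xS) xvy av; cyc_lia.
  by move: (xyN _ bD) (vbN _ yS) xvy vb; cyc_lia.
split=> // z zS; have [->|zv] := eqVneq z v => //.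
by apply: xyN; rewrite !inE zv.
Qed.

(* [k] edges cover at most [2k] vertices, so either [S] has a vertex isolated
   in [F], whose fan works, or [#|S| >= 6]; then the [#|S|] short diagonals are
   distinct, one of them is not in [F], and the ear below it can be cut off. *)
Lemma few_edges_triangulable F S :
  F \subset complete_edges n -> 2 < #|S| ->
  (forall a b, next S a b -> [set a; b] \notin F) ->
  #|[set e in F | e \subset S]| <= #|S| - 3 ->
  triangulable F S.
Proof.
move=> FK; have [m] := ubnP #|S|; elim: m => // m IHm in S * => Sm S3 sideF FS.
case iso: [exists v in S, [forall x in S, [set v; x] \notin F]].
  case/exists_inP: iso => v vS /forall_inP; exact: fan_triangulable.
have {}iso v : v \in S -> exists2 x, x \in S & [set v; x] \in F.
  move=> vS; have := negbT iso; rewrite negb_exists_in => /forall_inP/(_ v vS).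
  by rewrite negb_forall_in => /exists_inP[x xS /negPn]; exists x.
have S6 : 6 <= #|S|.
  have: S \subset cover [set e in F | e \subset S].
    apply/subsetP=> v vS; have [x xS vxF] := iso v vS.
    by apply/bigcupP; exists [set v; x]; rewrite ?set21 // inE vxF subUset !sub1set vS.
  move/subset_leq_card/leq_trans/(_ (leq_card_cover _)).
  rewrite (eq_bigr (fun=> 2)) => [|e]; first by rewrite sum_nat_const; lia.
  by rewrite inE => /andP[/(subsetP FK)]; rewrite inE => /eqP.
have S1 : 1 < #|S| by lia.
pose is_ear v e := [exists a, exists b,
  [&& e == [set a; b], a \in S, b \in S, a != v, v != b &
  [forall x in S, ~~ cyc a x v && ~~ cyc v x b]]].
have is_earP v e : v \in S ->
    reflect (exists a b, [/\ e = [set a; b], next S a v & next S v b]) (is_ear v e).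
  move=> vS; apply: (iffP existsP).
    case=> a /existsP[b /and5P[/eqP-> aS bS av /andP[vb /forall_inP H]]].
    by exists a, b; split=> //; split=> // x /H /andP[].
  case=> a [b [-> [aS _ av H] [_ bS vb H']]]; exists a; apply/existsP; exists b.
  rewrite eqxx aS bS av vb; apply/forall_inP=> x xS.
  by rewrite H ?H'.
case free: [exists v in S, exists e, is_ear v e && (e \notin F)]; last first.
  pose ear v := odflt set0 [pick e | is_ear v e].
  have earP v : v \in S -> is_ear v (ear v).
    move=> vS; rewrite /ear; case: pickP => //= noe.
    have [a av] := prev_exists vS S1; have [b vb] := next_exists vS S1.
    by have /is_earP: is_ear v [set a; b] = false := noe _;
      case=> //; exists a, b.
  have earI : {in S &, injective ear}.
    move=> v w vS wS E; have /(is_earP _ _ vS)[a [b [Ev av vb]]] := earP v vS.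
    have /(is_earP _ _ wS)[a' [b' [Ew a'w wb']]] := earP w wS.
    move: E; rewrite Ev Ew => /set2_inj[[aa' bb']|[ab' ba']].
      by apply: next_inj vb wb' bb'.
    (* Otherwise [a], [v], [b], [w] would follow one another and close up, making [S] a
       quadrilateral; a fifth point [d] excludes this. *)
    subst a' b'; have [d dS] : exists2 d, d \in S & d \notin [:: v; w; a; b].
      by apply: exists_notin; apply: leq_trans S6.
    rewrite !inE !negb_or => /and4P[dv dw da db].
    case: av vb a'w wb' => [aS _ av avN] [_ bS vb vbN] [_ _ bw bwN] [_ _ wa waN].
    move: (avN _ dS) (vbN _ dS) (bwN _ dS) (waN _ dS) dv dw da db av vb bw wa.
    by cyc_lia.
  have /subset_leq_card : ear @: S \subset [set e in F | e \subset S].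
    apply/subsetP=> _ /imsetP[v vS ->].
    have := negbT free; rewrite negb_exists_in => /forall_inP/(_ v vS).
    rewrite negb_exists => /forallP/(_ (ear v)); rewrite earP //= negbK inE => ->.
    have /(is_earP _ _ vS)[a [b [-> [aS _ _ _] [_ bS _ _]]]] := earP v vS.
    by rewrite subUset !sub1set aS.
  by move/leq_trans/(_ FS); rewrite card_in_imset // leqNgt ltn_subrL (ltnW S1).
case/exists_inP: free => v vS /existsP[e /andP[/(is_earP _ _ vS)[a [b [-> av vb]]] abF]].
have [aS _ av' avN] := av; have [_ bS vb' vbN] := vb.
have [d dS] : exists2 d, d \in S & d \notin [:: v; a; b].
  by apply: exists_notin; apply: leq_trans S6.
rewrite !inE !negb_or => /and3P[dv da db].
have bda : cyc b d a.
  have ab : a != b.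
    apply/eqP=> ab; move: (avN _ dS) (vbN _ dS) dv da av' vb'; rewrite ab.
    by cyc_lia.
  move: (avN _ dS) (vbN _ dS) (avN _ bS) da dv db av' vb' ab.
  by cyc_lia.
have cS : #|S :\ v| = #|S|.-1 by rewrite (cardsD1 v S) vS.
apply: (ear_triangulable av vb dS bda abF); apply: IHm; rewrite ?cS.
- by rewrite -ltnS prednK // ltnW.
- by rewrite ltn_predRL (leq_trans _ S6).
- by move=> x y /(next_setD1 av vb)[/sideF|[-> ->]].
(* Since [v] is not isolated, at least one edge disappears with it, so the bound still holds for the
   smaller polygon. *)
- have [x xS vxF] := iso v vS.
  have: [set e in F | e \subset S :\ v] \subset
        [set e in F | e \subset S] :\ [set v; x].
    apply/subsetP=> e'; rewrite !inE subsetD1 => /andP[-> /andP[-> ve']].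
    by rewrite !andbT; apply: contraNneq ve' => ->; rewrite set21.
  move/subset_leq_card; move: FS.
  rewrite (cardsD1 [set v; x] [set e in F | e \subset S]) inE vxF subUset !sub1set vS xS /=.
  move: #|S| #|_ :\ [set v; x]| => k l; move: #|_| => m'; clear.
  by lia.
Qed.

(* Fans at [u] and [w] on the two sides of the diagonal [ts]. *)
Lemma double_fan_triangulable F t s u w :
  [set t; s] \notin F ->
  (exists x, cyc t x s) -> (exists x, cyc s x t) ->
  ~~ cyc s u t -> ~~ cyc t w s ->
  (forall x, ~~ cyc s x t -> [set u; x] \notin F) ->
  (forall x, ~~ cyc t x s -> [set w; x] \notin F) ->
  triangulable F [set: 'I_n].
Proof.
move=> tsF [c tcs] [d sdt] ut wt uF wF.
have gt2 (x y z : 'I_n) (A : {set 'I_n}) :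
    cyc x y z -> x \in A -> y \in A -> z \in A -> 2 < #|A|.
  move=> xyz xA yA zA; have: x |: [set y; z] \subset A.
    by rewrite !subUset !sub1set xA yA.
  move/subset_leq_card; rewrite cardsU1 cards2 !inE negb_or.
  have -> : y != z by move: xyz; cyc_lia.
  have -> : x != y by move: xyz; cyc_lia.
  by have -> : x != z by move: xyz; cyc_lia.
apply: (cut_triangulable (t := t) (s := s) (c := c) (d := d)); rewrite ?inE //.
- apply: (fan_triangulable (v := u)).
  + by rewrite !inE.
  + by apply: (gt2 _ _ _ _ tcs); rewrite !inE /=; move: tcs; cyc_lia.
  + by move=> x; rewrite !inE => /uF.
- apply: (fan_triangulable (v := w)).
  + by rewrite !inE.
  + by apply: (gt2 _ _ _ _ sdt); rewrite !inE /=; move: sdt; cyc_lia.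
  + by move=> x; rewrite !inE => /wF.
Qed.

End Polygons.

(** * The successor map and the cyclic labellings it generates *)

Section CyclicOrder.
Variable n : nat.
Implicit Types (i j : nat) (x y : 'I_n).

Lemma cycN_ordS x y : ~~ cyc x y (ordS x).
Proof.
have: (x.+1 < n /\ x.+1 %% n = x.+1) \/ (x.+1 = n /\ x.+1 %% n = 0).
  have := ltn_ord x; rewrite leq_eqVlt => /orP[/eqP xn|xn].
    by right; rewrite xn modnn.
  by left; rewrite modn_small.
by move: (ltn_ord y) => yn; rewrite /cyc /=; case=> [[? ->]|[? ->]]; lia.
Qed.

Lemma ordS_neq x : 1 < n -> x != ordS x.
Proof.
move=> n1; rewrite -val_eqE /=; have := ltn_ord x; rewrite leq_eqVlt => /orP[/eqP xn|xn].
  by rewrite xn modnn; apply/eqP; lia.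
by rewrite modn_small // ltn_eqF.
Qed.

Lemma next_ordS x : 1 < n -> next [set: 'I_n] x (ordS x).
Proof. by move=> n1; split; rewrite ?inE ?ordS_neq // => y _; apply: cycN_ordS. Qed.

Lemma next_setT x y : 1 < n -> next [set: 'I_n] x y -> y = ordS x.
Proof. by move=> n1 xy; apply: next_fun xy (next_ordS x n1) erefl. Qed.

Lemma val_iter_ordS i x : iter i (@ordS n) x = (x + i) %% n :> nat.
Proof.
elim: i => [|i IHi] /=; first by rewrite addn0 modn_small.
by rewrite IHi -addn1 modnDml -addnA addn1.
Qed.

Lemma iter_ordS_inj i j x : i < n -> j < n ->
  iter i (@ordS n) x = iter j (@ordS n) x -> i = j.
Proof.
move=> ni nj /(congr1 val) /=; rewrite !val_iter_ordS => /eqP.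
by rewrite eqn_modDl !modn_small // => /eqP.
Qed.

Lemma iter_ordS_n x : iter n (@ordS n) x = x.
Proof. by apply: val_inj; rewrite /= val_iter_ordS modnDr modn_small. Qed.

Lemma iter_ordS_surj x y : exists2 i, i < n & y = iter i (@ordS n) x.
Proof.
exists ((n + y - x) %% n); first by rewrite ltn_mod (leq_ltn_trans _ (ltn_ord x)).
apply: val_inj; rewrite /= val_iter_ordS modnDmr subnKC.
  by rewrite modnDl modn_small.
by rewrite (leq_trans (ltnW (ltn_ord x))) // leq_addr.
Qed.

Lemma iter_ordS_labelling x : cyclic_labelling (fun i => iter i (@ordS n) x).
Proof.
split=> [i j|i|i]; first exact: iter_ordS_inj.
  by rewrite iterD iter_ordS_n.
by apply/imsetP; exists (iter i (@ordS n) x).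
Qed.

Lemma iter_ordS_pred x : iter n.-1 (@ordS n) x = ord_pred x.
Proof.
rewrite -[LHS](@ordSK n) -iterS prednK ?iter_ordS_n //.
exact: leq_ltn_trans (ltn_ord x).
Qed.

End CyclicOrder.

(** * Edge sets that block every triangulation *)

Section NonTriangulable.
Variables (n : nat) (F : {set {set 'I_n}}).
Hypotheses (n_gt4 : 4 < n) (FK : F \subset complete_edges n)
  (F_leq : #|F| <= n - 2) (F_inner : [disjoint F & boundary_edges n])
  (F_block : ~~ triangulable F [set: 'I_n]).
Implicit Types (b t s u v w x y : 'I_n).

Let n_gt1 : 1 < n. Proof. exact: leq_trans n_gt4. Qed.

Lemma edge_neq x y : [set x; y] \in F -> x != y.
Proof. by move/(subsetP FK); rewrite inE cards2; case: (x != y). Qed.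

Lemma side_notin x y : next [set: 'I_n] x y -> [set x; y] \notin F.
Proof.
move/(next_setT n_gt1) ->; rewrite (disjointFl F_inner) //.
by apply/imsetP; exists x.
Qed.

Lemma edge_at x : exists y, [set x; y] \in F.
Proof.
apply/existsP; apply: contraNT F_block; rewrite negb_exists => /forallP xF.
by apply: (@fan_triangulable n F _ x); rewrite ?cardsT ?card_ord ?inE // ltnW // ltnW.
Qed.

Lemma deg_gt0 x : 0 < deg F x.
Proof.
have [y xyF] := edge_at x.
by apply/card_gt0P; exists [set x; y]; rewrite inE xyF set21.
Qed.

Lemma pendantN b : ~~ pendant F b = (1 < deg F b).
Proof. by rewrite /pendant eqn_leq deg_gt0 andbT -ltnNge. Qed.

Lemma card_blocker : #|F| = n - 2.
Proof.
apply/eqP; rewrite eqn_leq F_leq leqNgt; apply: contra F_block => Fn.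
apply: few_edges_triangulable; rewrite ?cardsT ?card_ord //.
- by rewrite ltnW // ltnW.
- exact: side_notin.
- rewrite (_ : [set e in F | _] = F); first by move: Fn n_gt4; clear; lia.
  by apply/setP=> e; rewrite inE subsetT andbT.
Qed.

(** Removing [b] would delete at least two edges, leaving at most [n - 4 = (n - 1) - 3] on the
    remaining [n - 1] vertices, which is few enough to triangulate. *)
Lemma ear_in b : ~~ pendant F b -> [set ord_pred b; ordS b] \in F.
Proof.
rewrite pendantN => degb; apply: contraNT F_block => earF.
have nab := next_ordS (ord_pred b) n_gt1; rewrite ord_predK in nab.
have nbc := next_ordS b n_gt1.
have [d _] : exists2 d, d \in [set: 'I_n] & d \notin [:: ord_pred b; b; ordS b].
  by apply: exists_notin; rewrite cardsT card_ord ltnW.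
rewrite !inE !negb_or => /and3P[da db dc].
have cda : cyc (ordS b) d (ord_pred b).
  have [_ _ ab abN] := nab; have [_ _ bc bcN] := nbc.
  have ac : ord_pred b != ordS b.
    apply/eqP=> ac; move: (abN d (in_setT _)) (bcN d (in_setT _)) da db ab.
    by rewrite -ac; cyc_lia.
  by move: (abN d (in_setT _)) (bcN d (in_setT _)) (abN (ordS b) (in_setT _))
    da db dc ab bc ac; cyc_lia.
apply: (ear_triangulable nab nbc (in_setT d) cda earF).
have cT : #|[set: 'I_n] :\ b| = n.-1.
  by have := congr1 predn (cardsD1 b [set: 'I_n]); rewrite inE cardsT card_ord => ->.
apply: few_edges_triangulable; rewrite ?cT //.
- by rewrite ltn_predRL ltnW.
- by move=> x y /(next_setD1 nab nbc)[/side_notin|[-> ->]].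
- have -> : [set e in F | e \subset [set: 'I_n] :\ b] = F :\: [set e in F | b \in e].
    apply/setP=> e; rewrite !inE subsetD1 subsetT.
    by case: (e \in F); rewrite /= ?andbF ?andbT.
  have := cardsID [set e in F | b \in e] F.
  have /setIidPr -> : [set e in F | b \in e] \subset F.
    by apply/subsetP=> e; rewrite inE => /andP[].
  by move: degb F_leq; rewrite /deg; move: #|_| #|_ :\: _| #|F| n_gt4; clear; lia.
Qed.

Lemma pendant_uniq u x y : pendant F u ->
  [set u; x] \in F -> [set u; y] \in F -> x = y.
Proof.
rewrite /pendant => /cards1P[e Ee] uxF uyF.
have /set1P uxe : [set u; x] \in [set e] by rewrite -Ee inE uxF set21.
have /set1P uye : [set u; y] \in [set e] by rewrite -Ee inE uyF set21.
by have := set2_inj (etrans uxe (esym uye)) => -[[]|[-> ->]].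
Qed.

(** The only edge at [u] ends strictly beyond [ts], so the fan at [u] on its own side avoids [F];
    the same holds for [w] on the other side. Only [ts] itself can obstruct this double fan. *)
Lemma pendant_cut t s u u' w w' :
  pendant F u -> [set u; u'] \in F -> pendant F w -> [set w; w'] \in F ->
  cyc s u' t -> cyc t w' s -> ~~ cyc s u t -> ~~ cyc t w s ->
  [set t; s] \in F.
Proof.
move=> pu uu' pw ww' su't tw's sut tws; apply: contraNT F_block => tsF.
apply: (double_fan_triangulable tsF _ _ sut tws).
- by exists w'.
- by exists u'.
- by move=> x; apply: contra => /(pendant_uniq pu uu') <-.
- by move=> x; apply: contra => /(pendant_uniq pw ww') <-.
Qed.

(** Otherwise the diagonal from [w] to [ordS u'] separates [u'] from [w']. By [pendant_cut] it lies
    in [F], giving [w] a second neighbour. *)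
Lemma cross_ordS u u' w w' :
  pendant F u -> [set u; u'] \in F -> pendant F w -> [set w; w'] \in F ->
  cyc u w u' -> cyc u' w' u -> w' = ordS u'.
Proof.
move=> pu uu' pw ww' uwu' u'w'u; apply/eqP/negPn/negP => w'N.
have u't := ordS_neq u' n_gt1; have tN := cycN_ordS u' w'.
have u'tw' : cyc u' (ordS u') w' by move: u'w'u w'N u't tN; cyc_lia.
have: [set ordS u'; w] \in F.
  by apply: (pendant_cut pu uu' pw ww'); move: u'tw' u'w'u uwu'; cyc_lia.
by rewrite setUC => /(pendant_uniq pw ww') E; rewrite E eqxx in w'N.
Qed.

Lemma sum_deg : \sum_x deg F x = 2 * (n - 2).
Proof.
transitivity (\sum_(e in F) \sum_x (x \in e : nat)).
  by rewrite exchange_big; apply: eq_bigr => x _; rewrite /deg -sum1dep_card big_mkcondr.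
rewrite (eq_bigr (fun=> 2)) => [|e eF]; first by rewrite sum_nat_const card_blocker mulnC.
have := subsetP FK e eF; rewrite inE => /eqP <-.
by rewrite -sum1_card [RHS]big_mkcond.
Qed.

(** All degrees are at least 1, and at least 2 at non-pendant vertices, while their sum is
    [2 * (n - 2)]. This yields the upper bound on [k] in configuration (b). *)
Lemma card_nonpendant : #|[set x | ~~ pendant F x]| <= n - 4.
Proof.
suff: n + #|[set x | ~~ pendant F x]| <= \sum_x deg F x.
  by rewrite sum_deg; move: #|_| n_gt4; clear; lia.
have -> : n + #|[set x | ~~ pendant F x]| = \sum_x (1 + ~~ pendant F x).
  by rewrite big_split /= sum1_card card_ord -sum1dep_card big_mkcond.
by apply: leq_sum => x _; case: (boolP (pendant F x)); rewrite ?pendantN ?deg_gt0.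
Qed.

(** A chord [xy] crossing [uu'] has on each side a pendant vertex whose only neighbour is across, so
    [pendant_cut] applies. *)
Lemma pendant_pair_complete u u' x y :
  pendant F u -> pendant F u' -> [set u; u'] \in F ->
  cyc u x u' -> cyc u' y u -> [set x; y] \in F.
Proof.
move=> pu pu' uu' uxu' u'yu; have u'u : [set u'; u] \in F by rewrite setUC.
by rewrite setUC; apply: (pendant_cut pu uu' pu' u'u); move: uxu' u'yu; cyc_lia.
Qed.

Lemma pendant_pair_config u u' :
  pendant F u -> pendant F u' -> [set u; u'] \in F ->
  exists v : nat -> 'I_n, cyclic_labelling v /\ config_a F v.
Proof.
pose arc u u' := [set x : 'I_n | cyc u x u'].
have arc_card x y : x != y -> #|arc x y| + #|arc y x| = n - 2.
  move=> xy; rewrite -cardsUI (_ : arc x y :&: arc y x = set0); last first.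
    by apply/setP=> z; rewrite !inE; apply/negP; move: xy; cyc_lia.
  rewrite cards0 addn0 (_ : _ :|: _ = ~: [set x; y]).
    by have := congr1 (subn^~ 2) (cardsC [set x; y]); rewrite cards2 xy card_ord addKn.
  by apply/setP=> z; rewrite !inE; apply/idP/idP; move: xy; cyc_lia.
have arc_gt0 x y : [set x; y] \in F -> 0 < #|arc x y|.
  move=> xyF; rewrite lt0n; apply: contraL xyF => /eqP/cards0_eq arc0.
  have [->|xy] := eqVneq x y; first by apply/negP=> /edge_neq; rewrite eqxx.
  apply: side_notin; split; rewrite ?inE // => z _.
  by have /setP/(_ z) := arc0; rewrite !inE => ->.
wlog arc1 : u u' / #|arc u u'| = 1.
  move=> Hw pu pu' uu'; have u'u : [set u'; u] \in F by rewrite setUC.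
  have [/eqP c1|c1] := boolP (#|arc u u'| == 1); first exact: (Hw u u').
  have [/eqP c2|c2] := boolP (#|arc u' u| == 1); first exact: (Hw u' u).
  (* With both arcs longer than 1, the [|A||B| + 1] edges found exceed
     [|A| + |B| = n - 2]. *)
  pose G := [set [set xy.1; xy.2] | xy in setX (arc u u') (arc u' u)].
  have : [set u; u'] |: G \subset F.
    rewrite subUset sub1set uu'; apply/subsetP=> _ /imsetP[[x y] /setXP[xA yA] ->].
    by move: xA yA; rewrite !inE; apply: pendant_pair_complete.
  move/subset_leq_card; rewrite cardsU1 (_ : _ \notin G); last first.
    apply/imsetP=> -[[x y] /setXP[]]; rewrite !inE => /= ux uy /set2_inj[] [? ?]; subst.
      by move: ux; cyc_lia.
    by move: ux; cyc_lia.
  rewrite card_in_imset ?cardsX => [|[x y] [x' y'] /setXP[] + + /setXP[]].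
    rewrite card_blocker -(arc_card _ _ (edge_neq uu')).
    move: c1 c2 (arc_gt0 _ _ uu') (arc_gt0 _ _ u'u); move: #|_| #|_|; clear; nia.
  rewrite !inE /= => uxu' u'yu ux'u' u'y'u /set2_inj[[-> ->] //|[xy' yx']].
  by exfalso; move: uxu' u'y'u; rewrite xy'; cyc_lia.
move=> pu pu' uu'; have /eqP/cards1P[x arcx] := arc1.
have uu'_neq := edge_neq uu'.
have uxu' : cyc u x u' by have := set11 x; rewrite -arcx inE.
have arcN z : z != x -> ~~ cyc u z u'.
  by move=> zx; have := in_set1 z x; rewrite -arcx inE (negPf zx) => ->.
(* Labelling starts at the single vertex cut off by [uu']: it becomes the centre of the star, with
   [u'] and [u] as its two polygon neighbours. *)
pose v i := iter i (@ordS n) x.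
have v1 : v 1 = u'.
  symmetry; apply: next_setT => //; split; rewrite ?inE //; first by move: uxu'; cyc_lia.
  by move=> z _; have [->|/arcN] := eqVneq z x; move: uxu'; cyc_lia.
have vn : v n.-1 = u.
  rewrite /v iter_ordS_pred -[RHS]ordSK; congr ord_pred.
  apply: next_setT => //; split; rewrite ?inE //; first by move: uxu'; cyc_lia.
  by move=> z _; have [->|/arcN] := eqVneq z x; move: uxu'; cyc_lia.
exists v; split; first exact: iter_ordS_labelling.
have star : [set [set x; y] | y in arc u' u] =
    [set [set v 0; v i] | i : 'I_n & 2 <= i <= n - 2].
  apply/setP=> e; apply/imsetP/imsetP => [[y]|[i]].
    rewrite inE => u'yu ->; have [i ni yi] := iter_ordS_surj x y.
    exists (Ordinal ni); rewrite ?yi // inE /=.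
    have i0 : i != 0.
      by apply: contraTneq u'yu => E; rewrite yi E /=; move: uxu'; cyc_lia.
    have i1 : i != 1.
      by apply: contraTneq u'yu => E; rewrite yi E -/(v 1) v1; cyc_lia.
    have i2 : i != n.-1.
      by apply: contraTneq u'yu => E; rewrite yi E -/(v n.-1) vn; cyc_lia.
    by move: i0 i1 i2 ni n_gt4; clear; lia.
  rewrite inE => /andP[i2 in2] ->; exists (v i) => //; rewrite inE.
  have vN j : j < n -> i != j :> nat -> v i != v j.
    by move=> nj; apply: contra => /eqP/iter_ordS_inj-> //.
  have vix : v i != v 0 by apply: vN; move: n_gt4 i2 in2; clear; lia.
  have viu : v i != u by rewrite -vn; apply: vN; move: n_gt4 i2 in2; clear; lia.
  have viu' : v i != u' by rewrite -v1; apply: vN; move: n_gt4 i2 in2; clear; lia.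
  by move: (arcN _ vix) viu viu' uu'_neq; cyc_lia.
(* The star has [n - 3] edges, and together with [uu'] they number [n - 2 = #|F|]; one inclusion
   therefore suffices. *)
rewrite /config_a -star v1 vn [[set u'; u]]setUC; symmetry; apply/eqP.
rewrite eqEcard; apply/andP; split.
  rewrite subUset sub1set uu' andbT; apply/subsetP=> _ /imsetP[y + ->].
  by rewrite inE; apply: pendant_pair_complete.
rewrite card_blocker -(arc_card _ _ uu'_neq) arc1 setUC cardsU1.
rewrite (_ : _ \notin _); last first.
  apply/imsetP=> -[y _ /set2_inj[[ux _]|[_ u'x]]]; move: uxu'; rewrite ?ux ?u'x; cyc_lia.
rewrite card_in_imset // => y y' _ _ /set2_inj[[]//|[<- ->//]].
Qed.

End NonTriangulable.

(** * Crossing segments and alternation in the cyclic order *)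

Section Geometry.
Variable R : realFieldType.
Local Open Scope ring_scope.

Lemma orientC (a b c : 'rV[R]_2) : orient a b c = orient b c a.
Proof. rewrite /orient; ring. Qed.

(* For rays ordered inside a half-plane bounded by [oe], the three-term relation
   makes positivity of [orient o] transitive. *)
Lemma orient_plucker (o e a b c : 'rV[R]_2) :
  orient o e b * orient o a c = orient o e a * orient o b c + orient o e c * orient o a b.
Proof. rewrite /orient; ring. Qed.

Variables (n : nat) (p : 'I_n -> 'rV[R]_2).
Hypothesis pconv : convex_position p.

(** Induction on [k]: seen from [p i], with the side to [p i.+1] as reference ray, [orient_plucker]
    combines the triple [i, j, k] with the polygon side from [k] to [k.+1]. *)
Lemma orient_ltn (i j k : 'I_n) : (i < j < k)%N -> 0 < orient (p i) (p j) (p k).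
Proof.
have first_side (x y : 'I_n) (i1 : (x.+1 < n)%N) :
    (x.+1 < y)%N -> 0 < orient (p x) (p (Ordinal i1)) (p y).
  move=> xy; have -> : Ordinal i1 = ordS x by apply: val_inj; rewrite /= modn_small.
  apply: pconv; first by rewrite -val_eqE /=; lia.
  by rewrite -val_eqE /= modn_small //; lia.
case/andP=> ij; case: k => k kn /= jk.
have i1 : (i.+1 < n)%N by lia.
have [ij1|ij1] := eqVneq (i.+1) (j : nat).
  have -> : j = Ordinal i1 by apply: val_inj.
  by apply: first_side => /=; lia.
elim: k kn jk => // k IHk kn; rewrite ltnS leq_eqVlt => jk.
have kn' : (k < n)%N by lia.
have side : 0 < orient (p i) (p (Ordinal kn')) (p (Ordinal kn)).
  rewrite orientC; have -> : Ordinal kn = ordS (Ordinal kn').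
    by apply: val_inj; rewrite /= modn_small.
  apply: pconv; first by rewrite -val_eqE /=; lia.
  by rewrite -val_eqE /= modn_small //; lia.
case/orP: jk => [/eqP jk|jk].
  by rewrite (_ : j = Ordinal kn') //; apply: val_inj.
have ek : 0 < orient (p i) (p (Ordinal i1)) (p (Ordinal kn')).
  by apply: first_side => /=; lia.
have ek1 : 0 < orient (p i) (p (Ordinal i1)) (p (Ordinal kn)).
  by apply: first_side => /=; lia.
have ej : 0 < orient (p i) (p (Ordinal i1)) (p j) by apply: first_side => /=; lia.
rewrite -(pmulr_rgt0 _ ek) (orient_plucker _ _ (p j)).
by rewrite addr_gt0 // mulr_gt0 // IHk.
Qed.

Lemma orient_cyc (i j k : 'I_n) : cyc i j k -> 0 < orient (p i) (p j) (p k).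
Proof.
case/or3P=> /orient_ltn //; first by rewrite -orientC.
by rewrite orientC.
Qed.

(** [orient a b] is affine in its last argument and vanishes at the common point, so a convex
    combination of its values at [c] and [d] is zero. *)
Lemma orient_segment (a b c d : 'rV[R]_2) x :
  in_segment a b x -> in_segment c d x ->
  ~~ ((0 < orient a b c) && (0 < orient a b d)).
Proof.
move=> [s [s0 s1 Es]] [t [t0 t1 Et]]; apply/negP=> /andP[c0 d0].
have : (1 - t) * orient a b c + t * orient a b d = 0.
  have E i : (1 - s) * a 0 i + s * b 0 i = (1 - t) * c 0 i + t * d 0 i.
    have := congr1 (fun v : 'rV[R]_2 => v 0 i) (etrans (esym Es) Et).
    by rewrite !mxE.
  have E0 := E 0; have E1 := E 1.
  transitivity ((b 0 0 - a 0 0) * ((1 - t) * c 0 1 + t * d 0 1 - a 0 1)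
     - (b 0 1 - a 0 1) * ((1 - t) * c 0 0 + t * d 0 0 - a 0 0)).
    by rewrite /orient; ring.
  by rewrite -E0 -E1; ring.
have [->|tn0] := eqVneq t 0.
  by rewrite subr0 mul1r mul0r addr0 => E; rewrite E ltxx in c0.
move/eqP; rewrite gt_eqF // ltr_wpDl //.
  by apply: mulr_ge0; [rewrite subr_ge0 | exact: ltW].
by rewrite mulr_gt0 // lt_def tn0.
Qed.

Lemma crossing_cyc (a b c d : 'I_n) : crossing p a b c d ->
  (cyc a c b && cyc b d a) || (cyc a d b && cyc b c a).
Proof.
case; rewrite /= !inE !negb_or => /and4P[/and3P[ab ac ad] /andP[bc bd] cd _] [x [abx cdx]].
(* [orient_segment] excludes only the left side of a directed segment; reversing [ab] covers the
   right side. *)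
have bax : in_segment (p b) (p a) x.
  case: abx => t [t0 t1 ->]; exists (1 - t); split; [lra | lra |].
  by rewrite addrC; congr (_ *: _ + _); ring.
have cycC y z w : cyc y z w -> cyc w y z by rewrite /cyc; lia.
have dich y : a != y -> b != y -> cyc a y b \/ cyc b y a.
  by move: ab; rewrite /cyc -!val_eqE /=; lia.
case: (dich c ac bc) (dich d ad bd) => acb [] adb; rewrite acb adb ?orbT //.
  have := orient_segment bax cdx.
  by rewrite (orient_cyc (cycC _ _ _ acb)) (orient_cyc (cycC _ _ _ adb)).
have := orient_segment abx cdx.
by rewrite (orient_cyc (cycC _ _ _ acb)) (orient_cyc (cycC _ _ _ adb)).
Qed.

End Geometry.

(** * Blocking sets in which no two pendant vertices are adjacent *)

Section PendantsApart.
Variables (n : nat) (F : {set {set 'I_n}}).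
Hypotheses (n_gt4 : 4 < n) (FK : F \subset complete_edges n)
  (F_leq : #|F| <= n - 2) (F_inner : [disjoint F & boundary_edges n])
  (F_block : ~~ triangulable F [set: 'I_n])
  (pendants_apart : forall u w : 'I_n, pendant F u -> [set u; w] \in F -> ~~ pendant F w).
Implicit Types (b u w : 'I_n).

(* Both [b] and [b'] start a run of non-pendant vertices; if they differ, the
   edges below them point the same way around the polygon and do not cross,
   and the diagonal joining their pendant ends gives a double fan. *)
Lemma run_start_unique b b' :
  ~~ pendant F b -> ~~ pendant F b' ->
  pendant F (ord_pred b) -> pendant F (ord_pred b') -> b = b'.
Proof.
have n_gt1 : 1 < n by apply: leq_trans n_gt4.
move=> nb nb' pu pw; apply/eqP/negPn/negP => bb'.
have uF := ear_in n_gt4 FK F_leq F_inner F_block nb.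
have wF := ear_in n_gt4 FK F_leq F_inner F_block nb'.
have nu' := pendants_apart pu uF; have nw' := pendants_apart pw wF.
have neq x y : pendant F x -> ~~ pendant F y -> x != y.
  by move=> px; apply: contraNneq => <-.
have uw : ord_pred b != ord_pred b' by rewrite (can_eq (@ord_predK n)).
have stepP (c x : 'I_n) : ~~ cyc (ord_pred c) x c.
  by have := cycN_ordS (ord_pred c) x; rewrite ord_predK.
(* As [c] and [ordS c] are not pendant, going around from [ord_pred c] one passes both before any
   other pendant vertex [d]. *)
have cyc_run c d : ~~ pendant F c -> pendant F (ord_pred c) -> pendant F d ->
    ord_pred c != d -> ~~ pendant F (ordS c) -> cyc (ord_pred c) (ordS c) d.
  move=> nc pc pd cd nc'.
  move: (stepP c d) (cycN_ordS c d) (stepP c (ordS c)) (neq _ _ pc nc) (neq _ _ pc nc')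
    (neq _ _ pd nc) (neq _ _ pd nc') cd (ordS_neq c n_gt1).
  by cyc_lia.
have uu'w := cyc_run _ _ nb pu pw uw nu'.
have ww'u : cyc (ord_pred b') (ordS b') (ord_pred b) by apply: cyc_run; rewrite // eq_sym.
have /(pendants_apart pw) : [set ord_pred b'; ord_pred b] \in F.
  by apply: (pendant_cut F_block pu uF pw wF); move: uu'w ww'u; cyc_lia.
by rewrite pu.
Qed.

(** Without such a vertex, pendancy would spread from one pendant vertex to all of them, and any
    edge would join two pendant vertices. *)
Lemma run_start : exists b, ~~ pendant F b && pendant F (ord_pred b).
Proof.
apply/existsP; apply: contraT => /existsPn noS.
have step i (q : 'I_n) : pendant F q -> pendant F (iter i (@ordS n) q).
  move=> pq; elim: i => //= i IHi; have := noS (iter i.+1 (@ordS n) q).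
  by rewrite iterS ordSK IHi andbT negbK.
have all_pendant x : pendant F x.
  have [q pq] : exists q, pendant F q.
    apply/existsP; apply: contraT => /existsPn nP.
    have := card_nonpendant n_gt4 FK F_leq F_inner F_block.
    rewrite (_ : [set x | _] = setT).
      by rewrite cardsT card_ord; move: n_gt4; clear; lia.
    by apply/setP=> z; rewrite !inE nP.
  by have [i _ ->] := iter_ordS_surj q x; apply: step.
have x : 'I_n by apply: (Ordinal (n := n) (m := 0)); apply: leq_trans n_gt4.
have [y xyF] := edge_at n_gt4 F_block x.
by have := pendants_apart (all_pendant x) xyF; rewrite all_pendant.
Qed.

Lemma apart_config_b (R : realFieldType) (p : 'I_n -> 'rV[R]_2) :
  convex_position p ->
  exists v : nat -> 'I_n, cyclic_labelling v /\ exists k, config_b p F v k.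
Proof.
move=> pconv; have n_gt1 : 1 < n by apply: leq_trans n_gt4.
have n_gt0 : 0 < n by apply: ltnW.
have earF := ear_in n_gt4 FK F_leq F_inner F_block.
have [b /andP[nb pb]] := run_start.
pose v i := iter i (@ordS n) b.
exists v; split; first exact: iter_ordS_labelling.
have vn : v n.-1 = ord_pred b by apply: iter_ordS_pred.
have ex_pendant : exists i, pendant F (v i) by exists n.-1; rewrite vn.
(* [k] is the length of the run of non-pendant vertices starting at [b]. *)
case: (ex_minnP ex_pendant) => k pk mink; exists k.
have kn : k < n by rewrite -[n]prednK // ltnS mink // vn.
have run i : i < k -> ~~ pendant F (v i).
  by rewrite ltnNge; apply: contra; apply: mink.
(* A non-pendant vertex following a pendant one starts a run, so it would be [v 0] again, too early
   in the labelling. *)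
have gap i : k <= i -> i < n -> pendant F (v i).
  elim: i => [|i IHi]; first by rewrite leqn0 => /eqP<-.
  rewrite leq_eqVlt => /orP[/eqP<- //|ki] in_.
  apply: contraT => ni.
  have : v i.+1 = v 0.
    apply: run_start_unique => //; rewrite /v iterS ordSK.
    exact: IHi (ltnW in_).
  by move/iter_ordS_inj => /(_ in_ n_gt0).
have vpred i : v (i + n.-1) = ord_pred (v i).
  by rewrite /v iterD iter_ordS_pred -[in RHS](ord_predK b) -iterSr iterS ordSK.
(* If [k = 1], the short diagonal below [b], which lies in [F], would join two pendant vertices. *)
have k_gt1 : 1 < k.
  rewrite ltnNge leq_eqVlt ltnS leqn0; apply/negP => /orP[] /eqP k0.
    by have := pendants_apart pb (earF b nb); rewrite -[ordS b]/(v 1) -k0 pk.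
  by move: pk; rewrite k0 (negPf nb).
have k_leq : k <= n - 4.
  apply: leq_trans (card_nonpendant n_gt4 FK F_leq F_inner F_block).
  rewrite -[k in k <= _]card_ord -(card_imset _ (f := fun i : 'I_k => v i)).
    apply/subset_leq_card/subsetP=> _ /imsetP[i _ ->].
    by rewrite inE run.
  by move=> i j /iter_ordS_inj ij; apply/val_inj/ij; apply: ltn_trans kn.
have adjacent u w i j : i < n -> j < n -> pendant F u -> pendant F w ->
    [set u; v i] \in F -> [set w; v j] \in F ->
    cyc u w (v i) -> cyc (v i) (v j) u -> j = i.+1.
  move=> in_ jn pu pw ui wj uwi iju.
  have : v j = v i.+1 by apply: (cross_ordS n_gt4 F_block pu ui pw wj).
  apply: iter_ordS_inj => //.
  (* Comparing labels requires [i.+1 < n]; it holds because [v i], being adjacent to a pendant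
     vertex, lies in the non-pendant run. *)
  have : i < k.
    rewrite ltnNge; apply: contra (pendants_apart pu ui) => ki.
    exact: gap.
  by move: k_leq n_gt4; clear; lia.
split; first by rewrite k_gt1.
- move=> i ik; split; last by rewrite vpred; apply: earF; apply: run.
  by rewrite -(pendantN n_gt4 F_block); apply: run.
- move=> i /andP[ki in_]; split; first exact: gap.
  have [w wF] := edge_at n_gt4 F_block (v i).
  by exists w; split=> //; apply: pendants_apart wF; apply: gap.
- move=> u w i j in_ jn pu pw ui wj /(crossing_cyc pconv)/orP[]/andP[h1 h2].
    by right; apply: (adjacent u w).
  by left; apply: (adjacent w u) => //; move: h1 h2; cyc_lia.
Qed.

End PendantsApart.

(** * Return to geometric triangulations, and conclusion *)

Lemma triangulable_admits (R : realFieldType) (n : nat) (p : 'I_n -> 'rV[R]_2)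
    (F : {set {set 'I_n}}) :
  1 < n -> convex_position p -> [disjoint F & boundary_edges n] ->
  triangulable F [set: 'I_n] -> admits_triangulation p (complete_edges n :\: F).
Proof.
move=> n_gt1 pconv F_inner /triangulableP[D [DT DF pD cD]]; split.
  rewrite subsetD disjoint_sym F_inner andbT; apply/subsetP=> _ /imsetP[i _ ->].
  by rewrite inE cards2 ordS_neq.
exists D; split; last 1 first.
- move=> a b c d abD cdD /(crossing_cyc pconv)/orP[] H.
    by have := planeP _ pD a b c d abD cdD; rewrite H.
  by rewrite setUC in cdD; have := planeP _ pD a b d c abD cdD; rewrite H.
- rewrite !subsetD DF andbT; apply/andP; split.
    apply: (subset_trans DT); apply/subsetP=> e /diagonalsP[a [b [c [d [-> _ acb _]]]]].
    rewrite inE cards2 (_ : a != b) //; move: acb; cyc_lia.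
  (* A boundary edge has an empty open arc on one side, so it is never a diagonal. *)
  rewrite -setI_eq0; apply/eqP/setP=> e; rewrite !inE; apply/andP=> -[/(subsetP DT)].
  move=> eT /imsetP[i _ Ei]; move: eT; rewrite Ei => /diagonals_cyc[[c _ ic] _].
  by have := cycN_ordS i c; rewrite ic.
- by rewrite cD cardsT card_ord.
Qed.

Theorem theorem2 (R : realFieldType) (n : nat) (p : 'I_n -> 'rV[R]_2)
    (F : {set {set 'I_n}}) :
  (6 <= n)%N ->
  convex_position p ->
  F \subset complete_edges n ->
  (#|F| <= n - 2)%N ->
  [disjoint F & boundary_edges n] ->
  ~ config_star p F ->
  admits_triangulation p (complete_edges n :\: F).
Proof.
move=> n6 pconv FK F_leq F_inner Nstar; have n_gt4 : 4 < n by apply: ltnW.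
apply: triangulable_admits => //; first by apply: leq_trans n6.
apply: contraT => F_block; case: Nstar; split.
- exact: card_blocker.
- exact: deg_gt0.
- have [|apart] := boolP [exists u, exists w,
      [&& pendant F u, pendant F w & [set u; w] \in F]].
    case/existsP=> u /existsP[w /and3P[pu pw uw]].
    have [v [vL va]] := pendant_pair_config n_gt4 FK F_leq F_inner F_block pu pw uw.
    by exists v; split=> //; left.
  have [|v [vL vb]] := apart_config_b n_gt4 FK F_leq F_inner F_block _ pconv.
    move=> u w pu uw; apply: contra apart => pw.
    by apply/existsP; exists u; apply/existsP; exists w; rewrite pu pw.
  by exists v; split=> //; right.
Qed.
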